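(* Fix an integer $k\geq 1$ and set $j=\lfloor k/2\rfloor$. Let $H_k(x,t)$ denote either of the generating functions $$F_k(x,t)=\sum_{a\geq 0}\sum_{c\geq 0} f_{k,c}(a)x^at^c,\qquad G_k(x,t)=\sum_{a\geq 0}\sum_{c\geq 0} g_{k,c}(a)x^at^c .$$ Then there exist a polynomial $N_k(x,t)\in\mathbb{Z}[x,t]$ and a polynomial $D_k(x)$ that is a product of cyclotomic polynomials (both depending on $k$ and on the choice of $H_k\in\{F_k,G_k\}$) such that $$H_k(x,t)=\frac{N_k(x,t)}{D_k(x)(1-tx)(1-t^2x)(1-t^3x)\cdots(1-t^jx)}\quad\text{if } k \text{ is even},$$ $$H_k(x,t)=\frac{N_k(x,t)}{D_k(x)(1-tx^2)(1-t^3x^2)(1-t^5x^2)\cdots(1-t^kx^2)}\quad\text{if } k\text{ is odd}.$$ In particular, for fixed $k$ and $c$, the functions $g_{k,c}(a)$ and $f_{k,c}(a)$ are quasipolynomials (in $a$).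
   Context: Here $\binom{a+k}{k}_q=\frac{(1-q^{a+1})(1-q^{a+2})\cdots(1-q^{a+k})}{(1-q)(1-q^2)\cdots(1-q^k)}$ is the $q$-binomial coefficient, a polynomial in $q$, and $[q^n]F(q)$ denotes the coefficient of $q^n$ in $F(q)$ (equal to $0$ if $n<0$). For integers $k\geq 1$, $c\geq 0$, $a\geq 0$, set $m=\lfloor ak/2\rfloor$ and define $g_{k,c}(a)=[q^{m-c}]\binom{a+k}{k}_q$ and $f_{k,c}(a)=g_{k,c}(a)-g_{k,c+1}(a)$. The generating functions are formal power series in $x$ and $t$. Cyclotomic polynomials are normalized to have constant term $1$ (so the first one is $\Phi_1(x)=1-x$); repetitions in the product are allowed. In the odd case the product $(1-tx^2)(1-t^3x^2)\cdots(1-t^kx^2)$ is over all odd exponents $1,3,\dots,k$ of $t$. With $\mathbb{N}=\{0,1,2,\dots\}$, a quasipolynomial is a function $h\colon\mathbb{N}\to\mathbb{C}$ of the form $h(n)=c_d(n)n^d+c_{d-1}(n)n^{d-1}+\cdots+c_0(n)$, where each $c_i(n)$ is a periodic function of $n$.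
   Formalization: The functions g_{k,c}(a) and f_{k,c}(a) are shown to agree with quasipolynomials for all sufficiently large a, not for every a: the literal claim fails, e.g. f_{1,0}(a) = 1, 1, 0, 0, 0, ... is not a quasipolynomial on all of N. *)

(* Defs.v *)
From HB Require Import structures.
From mathcomp Require Import all_boot all_order all_algebra all_field.
From mathcomp Require Import reals complex.

Set Implicit Arguments.
Unset Strict Implicit.
Unset Printing Implicit Defensive.

Import GRing.Theory.
Local Open Scope ring_scope.

Definition qbinom_num (a k : nat) : {poly int} :=
  \prod_(1 <= i < k.+1) (1 - 'X^(a + i)).

Definition qbinom_den (k : nat) : {poly int} :=
  \prod_(1 <= i < k.+1) (1 - 'X^i).

(* The leading coefficient of the denominator is a unit of int, so %/ is
   genuine Euclidean division; it is exact by qbinomE below. *)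
Definition qbinom (a k : nat) : {poly int} := qbinom_num a k %/ qbinom_den k.

Definition coefz (p : {poly int}) (n : int) : int :=
  if n is Posz n' then p`_n' else 0.

Definition g_ (k c a : nat) : int :=
  coefz (qbinom a k) (((a * k)./2)%:Z - c%:Z).

Definition f_ (k c a : nat) : int := g_ k c a - g_ k c.+1 a.

(* A formal power series over int in x and t is the function sending (a, c)
   to the coefficient of x^a t^c. *)
Definition fps2 : Type := nat -> nat -> int.

Definition fps2_mul (A B : fps2) : fps2 := fun a c =>
  \sum_(i < a.+1) \sum_(j < c.+1) A i j * B (a - i)%N (c - j)%N.

(* Z[x,t] is {poly {poly int}}: the outer variable is x, the inner one t. *)
Definition fps2_of_poly (P : {poly {poly int}}) : fps2 := fun a c => P`_a`_c.

Definition varx : {poly {poly int}} := 'X.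
Definition vart : {poly {poly int}} := 'X%:P.

(* H = N / P in Z[[x,t]], for a P with constant term 1, hence invertible. *)
Definition fps2_is_frac (H : fps2) (N P : {poly {poly int}}) : Prop :=
  P`_0`_0 = 1 /\ forall a c, fps2_mul H (fps2_of_poly P) a c = fps2_of_poly N a c.

(* P(x) in Z[x], seen in Z[x,t]. *)
Definition polyx (P : {poly int}) : {poly {poly int}} := map_poly polyC P.

Definition F_ (k : nat) : fps2 := fun a c => f_ k c a.
Definition G_ (k : nat) : fps2 := fun a c => g_ k c a.

(* Among the monic 'Phi_n, n >= 1, only 'Phi_1 = 'X - 1 has constant term -1;
   all the others have constant term 1. *)
Definition cyclotomic1 (n : nat) : {poly int} :=
  if n == 1%N then 1 - 'X else 'Phi_n.

Definition cyclotomic_product (D : {poly int}) : Prop :=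
  exists s : seq nat, all (leq 1) s /\ D = \prod_(n <- s) cyclotomic1 n.

Definition periodic (T : Type) (u : nat -> T) : Prop :=
  exists p : nat, (0 < p)%N /\ forall n, u (n + p)%N = u n.

Definition quasipolynomial (R : realType) (h : nat -> R[i]) : Prop :=
  exists (d : nat) (coef : nat -> nat -> R[i]),
    (forall i, (i <= d)%N -> periodic (coef i)) /\
    (forall n, h n = \sum_(i < d.+1) coef i n * n%:R ^+ i).

(* Being a quasipolynomial is meant for all large arguments: for instance
   f_ 1 0 takes the values 1, 1, 0, 0, 0, ..., and a quasipolynomial that
   vanishes at all large n is zero. *)
Definition eventually_quasipolynomial (R : realType) (u : nat -> int) : Prop :=
  exists h : nat -> R[i], quasipolynomial h /\
    exists n0 : nat, forall n, (n0 <= n)%N -> (u n)%:~R = h n.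

Lemma qbinom_den_lead_unit (k : nat) :
  lead_coef (qbinom_den k) \is a GRing.unit.
Proof.
rewrite /qbinom_den lead_coef_prod big_nat_cond rpred_prod // => i.
case/andP=> /andP[i0 _] _; rewrite -opprB lead_coefN.
by rewrite -['X^i - 1]/('X^i - 1%:P) lead_coefXnsubC.
Qed.

Lemma qbinomE (a k : nat) : qbinom a k * qbinom_den k = qbinom_num a k.
Proof.
apply: Pdiv.IdomainUnit.divpK; first exact: qbinom_den_lead_unit.
elim: k a => [|k IHk] a; first by rewrite /qbinom_num /qbinom_den !big_geq.
elim: a => [|a IHa]; first by rewrite dvdpp.
have -> : qbinom_num a.+1 k.+1 =
    qbinom_num a k.+1 + 'X^(a.+1) * ((1 - 'X^(k.+1)) * qbinom_num a.+1 k).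
  rewrite {1}/qbinom_num big_nat_recr //= -/(qbinom_num a.+1 k).
  have -> : qbinom_num a k.+1 = (1 - 'X^(a.+1)) * qbinom_num a.+1 k.
    rewrite /qbinom_num big_nat_recl //= addn1 [X in _ * X]big_add1 /=.
    by congr (_ * _); rewrite big_add1; apply: eq_bigr => i _; rewrite addSnnS.
  rewrite mulrA -mulrDl mulrC; congr (_ * _).
  by rewrite mulrBr mulr1 -exprD addrA subrK.
rewrite dvdp_addr // dvdp_mull // /qbinom_den big_nat_recr //= mulrC.
by rewrite dvdp_mul.
Qed.

(* Main.v *)
Require Import Defs.
From mathcomp Require Import all_boot all_order all_algebra all_field.
From mathcomp Require Import reals complex.
From mathcomp Require Import zify ring.

Set Implicit Arguments.
Unset Strict Implicit.
Unset Printing Implicit Defensive.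

Import Order.TTheory GRing.Theory Num.Theory.
Local Open Scope ring_scope.

(** Expand the numerator of the q-binomial coefficient over the subsets S of
    {1, ..., k}.  With P n the coefficient of q^n in 1 / ((1 - q) ... (1 - q^k)),
    extended by 0 to n < 0, and with s = #|S| and sigma the sum of S,
<<
      g_{k,c}(a) = sum_S (-1)^s P(floor(a k / 2) - a s - sigma - c).
>>
    When 2 s >= k the argument is negative and the term vanishes
    ([fps2_frac_expansion]).  When 2 s < k, replacing a by a + e, where e = 1 for
    even k and e = 2 for odd k, increases the argument by the constant
    r = e k / 2 - e s > 0; the values of r are the exponents of t in the
    required denominator.

    The series sum_{a,c} P(index(a) - c) x^a t^c of one such term is rational
    for two reasons ([fps2_frac_term]).  First, (1 - q^(r k!))^k is a multiple
    of (1 - q) ... (1 - q^k), so it turns P into a finitely supported sequence;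
    since a step of e k! in a is a step of r k! in the index, multiplying the
    series by D = (1 - x^(e k!))^k leaves, apart from finitely many a, a
    function of index(a) - c supported on a band of bounded width.  Second, that
    function is invariant under (a, c) |-> (a + e, c + r), so the factor
    1 - t^r x^e kills all but finitely many coefficients.  The product D does
    not depend on the term, so all terms have one common denominator.  The
    series F_k is the difference of G_k and of its analogue with c + 1 in place
    of c, and the latter amounts to raising every sigma by 1.

    For quasipolynomiality, read the rational form along a fixed power of t:
    dividing a polynomial by the factors 1 - t^r x^e, r > 0, keeps every
    coefficient of t^c polynomial in x ([rows_finite_div]).  So D times the
    series has finite rows, that is, a |-> g_{k,c}(a) is eventually annihilated
    by the k-th power of the difference operator of step e k!, and summing k
    times on each residue class gives polynomials
    ([ev_piecewise_poly_diff]). *)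

(** * Integer sequences as a module over polynomials *)

(** The product of p with the two-sided formal series of u.  Indexing by [int]
    makes the shift by 'X invertible, so that no truncation at 0 ever has to be
    tracked. *)
Definition conv (p : {poly int}) (u : int -> int) (n : int) : int :=
  \sum_(i < size p) p`_i * u (n - i%:Z).

Definition delta0 (n : int) : int := (n == 0)%:R.

Lemma conv_wide (p : {poly int}) (u : int -> int) (N : nat) (n : int) :
  (size p <= N)%N -> conv p u n = \sum_(i < N) p`_i * u (n - i%:Z).
Proof.
move=> leN; rewrite /conv (big_ord_widen _ (fun i => p`_i * u (n - i%:Z)) leN).
rewrite big_mkcond; apply: eq_bigr => i _; case: ltnP => // lei.
by rewrite nth_default ?mul0r.
Qed.

Lemma eq_conv (p : {poly int}) (u v : int -> int) (n : int) :
  (forall m, u m = v m) -> conv p u n = conv p v n.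
Proof. by move=> uv; apply: eq_bigr => i _; rewrite uv. Qed.

Lemma conv1 (u : int -> int) (n : int) : conv 1 u n = u n.
Proof. by rewrite /conv size_poly1 big_ord1 coef1 mul1r subr0. Qed.

Lemma convB (p q : {poly int}) (u : int -> int) (n : int) :
  conv (p - q) u n = conv p u n - conv q u n.
Proof.
pose N := maxn (size p) (size q).
have sD : (size (p - q)%R <= N)%N.
  by rewrite (leq_trans (size_polyD _ _)) // size_polyN.
rewrite (conv_wide _ _ sD) (@conv_wide p _ N _) ?leq_maxl //.
rewrite (@conv_wide q _ N _) ?leq_maxr // -sumrB.
by apply: eq_bigr => i _; rewrite coefB mulrBl.
Qed.

Lemma conv_mulXn (p : {poly int}) (i : nat) (u : int -> int) (n : int) :
  conv (p * 'X^i) u n = conv p u (n - i%:Z).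
Proof.
have sM : (size (p * 'X^i)%R <= i + size p)%N.
  have [->|p0] := eqVneq p 0; first by rewrite mul0r size_poly0.
  by rewrite size_Mmonic ?monicXn // size_polyXn addnS addnC.
rewrite (conv_wide _ _ sM) big_split_ord /= big1 ?add0r => [|j _].
  by apply: eq_bigr => j _; rewrite coefMXn ltnNge leq_addr /= addKn PoszD opprD addrA.
by rewrite coefMXn ltn_ord mul0r.
Qed.

(** Associativity is what makes division by the denominator of a q-binomial
    coefficient unnecessary: a factor acting on the sequence P cancels
    formally. *)
Lemma conv_mul (p q : {poly int}) (u : int -> int) (n : int) :
  conv (p * q) u n = conv p (conv q u) n.
Proof.
have -> : conv p (conv q u) n = \sum_(j < size q) q`_j * conv p u (n - j%:Z).
  rewrite /conv; under eq_bigr do rewrite big_distrr /=.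
  rewrite exchange_big; apply: eq_bigr => j _; rewrite big_distrr.
  by apply: eq_bigr => i _ /=; rewrite mulrCA addrAC.
elim/poly_ind: q n => [|q c IH] n.
  by rewrite mulr0 size_poly0 big_ord0 /conv size_poly0 big_ord0.
have sN : (size (q * 'X + c%:P)%R <= (size q).+1)%N.
  by rewrite size_MXaddC; case: ifP.
have widen (F : nat -> int) :
    \sum_(j < size (q * 'X + c%:P)) (q * 'X + c%:P)`_j * F j =
    \sum_(j < (size q).+1) (q * 'X + c%:P)`_j * F j.
  rewrite (big_ord_widen _ (fun j => (q * 'X + c%:P)`_j * F j) sN) big_mkcond.
  by apply: eq_bigr => i _; case: ltnP => // lei; rewrite nth_default ?mul0r.
rewrite (widen (fun j => conv p u (n - j%:Z))) big_ord_recl /=.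
rewrite coefD coefMX coefC /= add0r subr0.
have convC : conv (p * c%:P) u n = c * conv p u n.
  have sc : (size (p * c%:P)%R <= size p)%N.
    rewrite mulrC mul_polyC; exact: size_scale_leq.
  rewrite (conv_wide _ _ sc) /conv big_distrr; apply: eq_bigr => i _ /=.
  by rewrite coefMC mulrAC mulrC.
have -> : p * (q * 'X + c%:P) = p * q * 'X^1 - - (p * c%:P).
  by rewrite opprK mulrDr mulrA.
have convN (r : {poly int}) : conv (- r) u n = - conv r u n.
  by rewrite -[- r]add0r convB {1}/conv size_poly0 big_ord0 add0r.
rewrite convB convN opprK conv_mulXn IH convC addrC; congr (_ + _).
apply: eq_bigr => i _; rewrite coefD coefMX coefC /= addr0; congr (_ * conv _ _ _).
by rewrite /bump /= PoszD; ring.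
Qed.

Lemma conv_delta0 (p : {poly int}) (n : int) : conv p delta0 n = coefz p n.
Proof.
case: n => [n|n] /=; last first.
  by rewrite /conv big1 // => i _; rewrite /delta0; case: eqP => //=;
    [lia | rewrite mulr0].
have lN : (size p <= maxn (size p) n.+1)%N by rewrite leq_maxl.
have ln : (n < maxn (size p) n.+1)%N by rewrite leq_max ltnSn orbT.
rewrite (conv_wide _ _ lN) (bigD1 (Ordinal ln)) //= /delta0 subrr eqxx mulr1.
rewrite big1 ?addr0 // => i /eqP ni; case: eqP => [ein|]; last by rewrite mulr0.
by case: ni; apply: val_inj => /=; lia.
Qed.

(** The inverse is v n = u n + u (n - i) + u (n - 2 i) + ..., a finite sum
    because u vanishes on negative arguments. *)
Lemma conv_invert_1subXn (i : nat) (u : int -> int) :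
    (0 < i)%N -> (forall n, n < 0 -> u n = 0) ->
  exists v : int -> int, (forall n, n < 0 -> v n = 0) /\
    forall n, conv (1 - 'X^i) v n = u n.
Proof.
move=> i0 u0.
pose v (n : int) := \sum_(l < `|n|%N.+1) u (n - (i * l)%:Z).
have vE N n : (`|n| < N)%N -> v n = \sum_(l < N) u (n - (i * l)%:Z).
  move=> ltN; rewrite /v (big_ord_widen N (fun l => u (n - (i * l)%:Z)) ltN).
  rewrite big_mkcond; apply: eq_bigr => l _; case: ltnP => // lel.
  by rewrite u0 //; nia.
have v0 n : n < 0 -> v n = 0.
  by move=> n0; rewrite /v big1 // => l _; rewrite u0 //; lia.
exists v; split=> // n.
rewrite convB conv1 -['X^i]mul1r conv_mulXn conv1.
have [n0|n0] := ltP n 0; first by rewrite !v0 ?u0 //; lia.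
(* Any number of terms beyond the support works; N + 1 terms at n and N terms at
   n - i leave exactly the leading term u n. *)
pose N := (`|n| + i).+1.
rewrite (vE N.+1) ?(vE N); try lia.
rewrite big_ord_recl /= muln0 subr0 [u n + _]addrC -addrA [u n - _]addrC addrA.
rewrite -sumrB big1 ?add0r // => l _; rewrite /bump /=.
by apply/eqP; rewrite subr_eq0; apply/eqP; congr u; lia.
Qed.

(** The sequence P counts partitions of n into parts of size at most k. *)
Lemma conv_invert_qbinom_den (k : nat) :
  exists P : int -> int, (forall n, n < 0 -> P n = 0) /\
    forall n, conv (qbinom_den k) P n = delta0 n.
Proof.
elim: k => [|k [P [P0 PE]]].
  exists delta0; split=> [n n0|n]; last by rewrite /qbinom_den big_geq // conv1.
  by rewrite /delta0; case: eqP => //; lia.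
have [v [v0 vE]] := conv_invert_1subXn (ltn0Sn k) P0.
exists v; split=> // n; rewrite /qbinom_den big_nat_recr //= conv_mul.
by rewrite (eq_conv _ _ vE) PE.
Qed.

(** Each of the k factors of the denominator divides one copy of 1 - 'X^N. *)
Lemma qbinom_den_dvd_pow (k N : nat) :
    (forall i, (0 < i <= k)%N -> (i %| N)%N) ->
  exists cof, (1 - 'X^N) ^+ k = cof * qbinom_den k.
Proof.
elim: k => [|k IH] dvN.
  by exists 1; rewrite /qbinom_den big_geq // expr0 mulr1.
have [i /andP[i0 ik]|cof E] := IH; first by rewrite dvN // i0 ltnW.
have /dvdnP[l Nl] : (k.+1 %| N)%N by rewrite dvN ?ltn0Sn //=.
exists (cof * \sum_(i < l) 'X^(k.+1) ^+ i).
rewrite /qbinom_den big_nat_recr //= -/(qbinom_den k) exprSr E.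
have -> : 1 - 'X^N = (1 - 'X^(k.+1)) * \sum_(i < l) 'X^(k.+1) ^+ i :> {poly int}.
  by rewrite -[1 - 'X^N]opprB Nl mulnC exprM subrX1 -mulNr opprB.
by ring.
Qed.

(** * Rational power series in two variables *)

Definition fps2_frac (P : {poly {poly int}}) (H : fps2) : Prop :=
  exists N, forall a c, fps2_mul H (fps2_of_poly P) a c = fps2_of_poly N a c.

Lemma eq_fps2_mul (A A' B : fps2) (a c : nat) :
    (forall i j, (i <= a)%N -> (j <= c)%N -> A i j = A' i j) ->
  fps2_mul A B a c = fps2_mul A' B a c.
Proof.
move=> AA'; apply: eq_bigr => i _; apply: eq_bigr => j _.
by rewrite AA' // -ltnS.
Qed.

Lemma fps2_mul_poly (A B : {poly {poly int}}) (a c : nat) :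
  fps2_mul (fps2_of_poly A) (fps2_of_poly B) a c = (A * B)`_a`_c.
Proof.
rewrite coefM coef_sum; apply: eq_bigr => i _.
by rewrite coefM; apply: eq_bigr.
Qed.

(** Coefficients of a product up to a given degree only depend on truncations of
    the factors, which transfers associativity from the polynomial ring. *)
Definition trunc2 (n : nat) (H : fps2) : {poly {poly int}} :=
  \poly_(i < n) \poly_(j < n) H i j.

Lemma coef_trunc2 (n : nat) (H : fps2) (a c : nat) :
  (trunc2 n H)`_a`_c = if (a < n)%N && (c < n)%N then H a c else 0.
Proof.
rewrite coef_poly; case: ltnP => an /=; last by rewrite coef0.
by rewrite coef_poly; case: ifP.
Qed.

Lemma fps2_mul_trunc (n : nat) (H : fps2) (P : {poly {poly int}}) (a c : nat) :
    (a < n)%N -> (c < n)%N ->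
  fps2_mul H (fps2_of_poly P) a c = (trunc2 n H * P)`_a`_c.
Proof.
move=> an cn; rewrite -fps2_mul_poly; apply: eq_fps2_mul => i j ia jc.
by rewrite /fps2_of_poly coef_trunc2 (leq_ltn_trans ia) ?(leq_ltn_trans jc).
Qed.

Lemma fps2_mulA (H : fps2) (P Q : {poly {poly int}}) (a c : nat) :
  fps2_mul H (fps2_of_poly (P * Q)) a c =
  fps2_mul (fps2_mul H (fps2_of_poly P)) (fps2_of_poly Q) a c.
Proof.
pose n := (maxn a c).+1.
have [an cn] : (a < n)%N /\ (c < n)%N by rewrite !ltnS leq_maxl leq_maxr.
rewrite (@fps2_mul_trunc n) // mulrA -fps2_mul_poly.
apply: eq_fps2_mul => i j ia jc; rewrite (@fps2_mul_trunc n) //; lia.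
Qed.

Lemma fps2_mul1 (H : fps2) (a c : nat) :
  fps2_mul H (fps2_of_poly 1) a c = H a c.
Proof.
by rewrite (@fps2_mul_trunc (maxn a c).+1) ?mulr1 ?coef_trunc2;
  rewrite ?ltnS ?leq_maxl ?leq_maxr.
Qed.

Lemma fps2_mul_1subX (H : fps2) (r e a c : nat) :
  fps2_mul H (fps2_of_poly (1 - vart ^+ r * varx ^+ e)) a c =
  H a c - (if (e <= a)%N && (r <= c)%N then H (a - e)%N (c - r)%N else 0).
Proof.
have [an cn] : (a < (maxn a c).+1)%N /\ (c < (maxn a c).+1)%N.
  by rewrite !ltnS leq_maxl leq_maxr.
rewrite (fps2_mul_trunc _ _ an cn) mulrBr mulr1 !coefB coef_trunc2 an cn /=.
congr (_ - _); rewrite /vart /varx -rmorphXn /= mulrA coefMXn ltnNge.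
case: leqP => [ea|] /=; last by rewrite coef0.
rewrite coefMC coefMXn ltnNge; case: leqP => //= rc.
rewrite coef_trunc2 !(leq_ltn_trans (leq_subr _ _)) //.
Qed.

Lemma fps2_frac_mulr (P Q : {poly {poly int}}) (H : fps2) :
  fps2_frac P H -> fps2_frac (P * Q) H.
Proof.
move=> [N HN]; exists (N * Q) => a c; rewrite fps2_mulA.
by rewrite -[RHS]fps2_mul_poly; apply: eq_fps2_mul => i j _ _; apply: HN.
Qed.

Lemma fps2_fracB (P : {poly {poly int}}) (H H1 H2 : fps2) :
    (forall a c, H a c = H1 a c - H2 a c) ->
  fps2_frac P H1 -> fps2_frac P H2 -> fps2_frac P H.
Proof.
move=> HE [N1 HN1] [N2 HN2]; exists (N1 - N2) => a c.
rewrite /fps2_of_poly !coefB -/(fps2_of_poly _ _ _) -HN1.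
rewrite -[N2`_a`_c]/(fps2_of_poly _ _ _) -HN2 /fps2_mul -sumrB.
apply: eq_bigr => i _; rewrite -sumrB; apply: eq_bigr => j _.
by rewrite HE mulrBl.
Qed.

Lemma fps2_frac_finite (P : {poly {poly int}}) (H : fps2) (A : nat) :
    (forall a c, (A <= a)%N || (A <= c)%N ->
       fps2_mul H (fps2_of_poly P) a c = 0) ->
  fps2_frac P H.
Proof.
move=> fin; exists (trunc2 A (fps2_mul H (fps2_of_poly P))) => a c.
rewrite /fps2_of_poly coef_trunc2; case: ifP => // /negbT.
by rewrite negb_and -!leqNgt => /fin.
Qed.

(** * The series of one term of the expansion *)

(** The argument of the partition sequence in the term of a subset with [s]
    elements and sum [sigma], at c = 0. *)
Definition term_index (k s sigma a : nat) : int :=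
  ((a * k)./2)%:Z - (a * s)%:Z - sigma%:Z.

Lemma polyx_pow (M j : nat) :
  polyx ((1 - 'X^M) ^+ j) = (1 - vart ^+ 0 * varx ^+ M) ^+ j.
Proof.
rewrite /polyx rmorphXn rmorphB rmorph1 /= map_polyXn.
by rewrite expr0 mul1r.
Qed.

(** Multiplication by a power of 1 - x^M iterates a backward difference of step M
    along each row c. *)
Lemma fps2_mul_polyxS (H : fps2) (M j a c : nat) :
  fps2_mul H (fps2_of_poly (polyx ((1 - 'X^M) ^+ j.+1))) a c =
  fps2_mul H (fps2_of_poly (polyx ((1 - 'X^M) ^+ j))) a c -
  (if (M <= a)%N
   then fps2_mul H (fps2_of_poly (polyx ((1 - 'X^M) ^+ j))) (a - M)%N c else 0).
Proof.
by rewrite !polyx_pow exprSr fps2_mulA fps2_mul_1subX leq0n andbT subn0.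
Qed.

Lemma fps2_mul_polyx0 (H : fps2) (M a c : nat) :
  fps2_mul H (fps2_of_poly (polyx ((1 - 'X^M) ^+ 0))) a c = H a c.
Proof. by rewrite polyx_pow expr0 fps2_mul1. Qed.

Lemma fps2_mul_polyx_vanish (H : fps2) (M j A C : nat) :
    (forall a c, (a < A)%N -> (C <= c)%N -> H a c = 0) ->
  forall a c, (a < A)%N -> (C <= c)%N ->
    fps2_mul H (fps2_of_poly (polyx ((1 - 'X^M) ^+ j))) a c = 0.
Proof.
move=> H0; elim: j => [|j IH] a c aA Cc; first by rewrite fps2_mul_polyx0 H0.
rewrite fps2_mul_polyxS IH // sub0r; case: ifP => _; last by rewrite oppr0.
by rewrite IH ?oppr0 // (leq_ltn_trans (leq_subr _ _)).
Qed.

(** The hypothesis on [e * k] encodes both parities: e = 1, w = k / 2 for even k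
    and e = 2, w = k for odd k. *)
Lemma term_indexD (k s sigma e w a : nat) :
    (e * k = w.*2)%N -> (e * s <= w)%N ->
  term_index k s sigma (a + e) = term_index k s sigma a + (w - e * s)%N%:Z.
Proof.
move=> ek esw; rewrite /term_index !mulnDl ek halfD odd_double andbF doubleK; lia.
Qed.

Lemma term_indexDM (k s sigma e w a l : nat) :
    (e * k = w.*2)%N -> (e * s <= w)%N ->
  term_index k s sigma (a + l * e) = term_index k s sigma a + (l * (w - e * s))%N%:Z.
Proof.
move=> ek esw; elim: l => [|l IH]; first by rewrite !mul0n !addn0 addr0.
by rewrite mulSnr addnA (term_indexD _ _ ek esw) IH [in RHS]mulSnr PoszD addrA.
Qed.

(** This is where 2 s < k enters: the index tends to infinity with a. *)
Lemma term_index_lower (k s sigma a : nat) :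
  (s.*2 < k)%N -> a%:Z <= (term_index k s sigma a + sigma%:Z) *+ 2 + 1.
Proof.
move=> sk; rewrite /term_index.
have : (a * (s.*2).+1 <= a * k)%N by rewrite leq_mul2l sk orbT.
rewrite mulnS -doubleMr; have := odd_double_half (a * k); lia.
Qed.

Lemma term_index_upper (k s sigma a : nat) : term_index k s sigma a <= (a * k)%:Z.
Proof. rewrite /term_index; have := odd_double_half (a * k); lia. Qed.

(** Past a = k e k!, multiplying by the first factor gives a finitely supported
    function of index(a) - c; it is constant along (e, r), so the second factor
    leaves only finitely many nonzero coefficients. *)
Lemma fps2_frac_term (k e w s sigma : nat) (P : int -> int) :
    (0 < e)%N -> (e * k = w.*2)%N -> (s.*2 < k)%N ->
    (forall n, n < 0 -> P n = 0) ->
    (forall n, conv (qbinom_den k) P n = delta0 n) ->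
  fps2_frac (polyx ((1 - 'X^(e * k`!)) ^+ k) *
             (1 - vart ^+ (w - e * s) * varx ^+ e))
            (fun a c => P (term_index k s sigma a - c%:Z)).
Proof.
move=> e0 ek sk P0 PE; set H : fps2 := fun a c => _.
have esw : (e * s < w)%N.
  have : (e * (s.*2) < e * k)%N by rewrite ltn_pmul2l.
  by rewrite ek -!mul2n mulnCA ltn_pmul2l.
set r := (w - e * s)%N; have r0 : (0 < r)%N by rewrite subn_gt0.
set L := k`!; set M := (e * L)%N.
have [cof cofE] : exists cof, (1 - 'X^(L * r)) ^+ k = cof * qbinom_den k.
  by apply: qbinom_den_dvd_pow => i ik; rewrite dvdn_mulr // dvdn_fact.
pose K j := fps2_mul H (fps2_of_poly (polyx ((1 - 'X^M) ^+ j))).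
have idxM a : term_index k s sigma (a + M) = term_index k s sigma a + (L * r)%N%:Z.
  by rewrite /M mulnC (term_indexDM _ _ _ ek) // ltnW.
have KE j a c : (j * M <= a)%N ->
    K j a c = conv ((1 - 'X^(L * r)) ^+ j) P (term_index k s sigma a - c%:Z).
  elim: j a => [|j IH] a; first by rewrite /K fps2_mul_polyx0 expr0 conv1.
  rewrite mulSn => la; rewrite /K fps2_mul_polyxS -/(K j) (leq_trans _ la) ?leq_addr //.
  rewrite !IH; try lia.
  rewrite exprSr mulrBr mulr1 convB conv_mulXn; congr (_ - conv _ _ _).
  have /subnK aE : (M <= a)%N by lia.
  by rewrite -{2}aE idxM; lia.
have KkE a c : (k * M <= a)%N ->
    K k a c = coefz cof (term_index k s sigma a - c%:Z).
  by move=> la; rewrite KE // cofE conv_mul (eq_conv _ _ PE) conv_delta0.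
have cof_large n : (size cof)%:Z <= n -> coefz cof n = 0.
  by case: n => // n; rewrite lez_nat => ln /=; rewrite nth_default.
pose A := (k * M + e)%N.
have Ksmall a c : (a < A)%N -> ((A * k).+1 <= c)%N -> K k a c = 0.
  apply: fps2_mul_polyx_vanish => {}a {}c aA lc; apply: P0.
  have := term_index_upper k s sigma a.
  have : (a * k <= A * k)%N by rewrite leq_mul2r (ltnW aA) orbT.
  lia.
(* For a < A the index is at most A k, so c > A k + r makes all coefficients
   vanish; for c < r, a beyond twice the support of cof pushes the index past
   that support. *)
pose B := (A + A * k + r + (size cof + r + sigma).*2).+2.
apply: (@fps2_frac_finite _ _ B) => a c ac.
rewrite fps2_mulA -/(K k) fps2_mul_1subX.
have [aA|Aa] := ltnP a A.
  have Bc : (B <= c)%N by case/orP: ac => //; rewrite /B; lia.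
  rewrite Ksmall //; last by move: Bc; rewrite /B; lia.
  case: ifP => _; last by rewrite subr0.
  rewrite Ksmall ?subr0 //; first by lia.
  by move: Bc; rewrite /B; lia.
have -> /= : (e <= a)%N by move: Aa; rewrite /A; lia.
have kMa : (k * M <= a)%N by move: Aa; rewrite /A; lia.
case: leqP => rc.
  rewrite !KkE //; last by move: Aa; rewrite /A; lia.
  apply/eqP; rewrite subr_eq0; apply/eqP; congr coefz.
  have ea : (e <= a)%N by move: Aa; rewrite /A; lia.
  by rewrite -{1}(subnK ea) (term_indexD _ _ ek (ltnW esw)) -/r; lia.
have Ba : (B <= a)%N by case/orP: ac => //; rewrite /B; lia.
rewrite subr0 KkE // cof_large //.
have := term_index_lower sigma a sk; move: Ba; rewrite /B; lia.
Qed.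

(** * Assembling the q-binomial coefficient *)

Lemma fps2_frac_vanish (Q : {poly {poly int}}) (H : fps2) :
  (forall a c, H a c = 0) -> fps2_frac Q H.
Proof.
move=> H0; apply: (@fps2_frac_finite _ _ 0) => a c _.
by rewrite /fps2_mul big1 // => i _; rewrite big1 // => j _; rewrite H0 mul0r.
Qed.

(** One denominator for all terms: a step of e k! in a moves the index by r k!,
    a multiple of every i <= k whatever the value of r. *)
Definition common_den (k e : nat) (rs : seq nat) : {poly {poly int}} :=
  polyx ((1 - 'X^(e * k`!)) ^+ k) * \prod_(i <- rs) (1 - vart ^+ i * varx ^+ e).

(** Each factor 1 - q^(a+j) of the numerator splits a term (s, sigma) into the
    terms (s, sigma) and (s + 1, sigma + j), so induction on the number of factors
    expands over subsets without naming them.  The invariant s <= sigma ensures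
    that a term with 2 s >= k has sigma > 0, hence a negative index for all a and
    c. *)
Lemma fps2_frac_expansion (k e w : nat) (rs : seq nat) (P : int -> int) :
    (0 < k)%N -> (0 < e)%N -> (e * k = w.*2)%N ->
    (forall s, (s.*2 < k)%N -> (w - e * s)%N \in rs) ->
    (forall n, n < 0 -> P n = 0) ->
    (forall n, conv (qbinom_den k) P n = delta0 n) ->
  forall j s sigma, (s <= sigma)%N ->
  fps2_frac (common_den k e rs)
    (fun a c => conv (qbinom_num a j) P (term_index k s sigma a - c%:Z)).
Proof.
move=> k0 e0 ek rsP P0 PE; elim=> [|j IH] s sigma le_s.
  have convE a n : conv (qbinom_num a 0) P n = P n.
    by rewrite /qbinom_num big_geq // conv1.
  have [sk|ks] := ltnP s.*2 k.
    have [N NE] : fps2_frac (common_den k e rs)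
        (fun a c => P (term_index k s sigma a - c%:Z)).
      rewrite /common_den (big_rem _ (rsP _ sk)) /= mulrA.
      by apply: fps2_frac_mulr; apply: fps2_frac_term.
    exists N => a c; rewrite -NE; apply: eq_fps2_mul => i l _ _; exact: convE.
  apply: fps2_frac_vanish => a c; rewrite convE P0 // /term_index.
  have : (a * k <= (a * s).*2)%N by rewrite -muln2 -mulnA muln2 leq_mul2l ks orbT.
  have := odd_double_half (a * k); move: (a * k)%N => ak.
  have : (0 < s)%N by lia.
  lia.
apply: (fps2_fracB _ (IH s sigma le_s) (IH s.+1 (sigma + j.+1)%N _)); last by lia.
move=> a c; rewrite {1}/qbinom_num big_nat_recr //= -/(qbinom_num a j).
rewrite mulrBr mulr1 convB conv_mulXn; congr (_ - conv _ _ _).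
by rewrite /term_index mulnS; lia.
Qed.

Lemma g_conv (k c a : nat) (P : int -> int) :
    (forall n, conv (qbinom_den k) P n = delta0 n) ->
  g_ k c a = conv (qbinom_num a k) P (term_index k 0 0 a - c%:Z).
Proof.
move=> PE; rewrite /g_ -conv_delta0 -qbinomE conv_mul (eq_conv _ _ PE).
by rewrite /term_index muln0 !subr0.
Qed.

Lemma fps2_frac_FG (k e w : nat) (rs : seq nat) (H : fps2) :
    (0 < k)%N -> (0 < e)%N -> (e * k = w.*2)%N ->
    (forall s, (s.*2 < k)%N -> (w - e * s)%N \in rs) ->
  H = F_ k \/ H = G_ k -> fps2_frac (common_den k e rs) H.
Proof.
move=> k0 e0 ek rsP; have [P [P0 PE]] := conv_invert_qbinom_den k.
have frac := fps2_frac_expansion k0 e0 ek rsP P0 PE k.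
have fracG : fps2_frac (common_den k e rs) (G_ k).
  have [N NE] := frac 0%N 0%N (leqnn _).
  exists N => a c; rewrite -NE; apply: eq_fps2_mul => i j _ _; exact: g_conv.
case=> ->; last exact: fracG.
apply: (fps2_fracB _ fracG (frac 0%N 1%N isT)) => a c.
rewrite /F_ /f_ (@g_conv k c.+1 _ P) //; congr (_ - conv _ _ _).
by rewrite /term_index; lia.
Qed.

(** * Quasipolynomiality of the rows *)

Definition rows_finite (H : fps2) : Prop :=
  forall c, exists A, forall a, (A <= a)%N -> H a c = 0.

(** Since r > 0, the row c of H is the row c of the product plus a shifted
    earlier row of H. *)
Lemma rows_finite_div1 (H : fps2) (r e : nat) :
    (0 < r)%N ->
    rows_finite (fps2_mul H (fps2_of_poly (1 - vart ^+ r * varx ^+ e))) ->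
  rows_finite H.
Proof.
move=> r0 fin; elim/ltn_ind=> c IH; have [A HA] := fin c.
have [rc|cr] := leqP r c; last first.
  by exists A => a /HA; rewrite fps2_mul_1subX [(r <= c)%N]leqNgt cr andbF subr0.
have [B HB] := IH (c - r)%N ltac:(lia).
exists (A + B + e)%N => a la; have := HA a ltac:(lia).
by rewrite fps2_mul_1subX; case: ifP => _; rewrite ?HB ?subr0 //; lia.
Qed.

Lemma rows_finite_div (rs : seq nat) (e : nat) (H : fps2) :
    all (leq 1) rs ->
    rows_finite (fps2_mul H
      (fps2_of_poly (\prod_(i <- rs) (1 - vart ^+ i * varx ^+ e)))) ->
  rows_finite H.
Proof.
elim: rs H => [|r rs IH] H /=.
  move=> _ fin c; have [A HA] := fin c; exists A => a /HA.
  by rewrite big_nil fps2_mul1.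
case/andP=> r0 rs0 fin; apply: (@rows_finite_div1 H r e r0); apply: (IH _ rs0) => c.
have [A HA] := fin c; exists A => a /HA.
by rewrite big_cons fps2_mulA.
Qed.

Lemma rows_finite_poly (N : {poly {poly int}}) : rows_finite (fps2_of_poly N).
Proof.
move=> c; exists (size N) => a la.
by rewrite /fps2_of_poly (nth_default _ la) coef0.
Qed.

Lemma fps2_frac_rows (k e : nat) (rs : seq nat) (H : fps2) :
    all (leq 1) rs -> fps2_frac (common_den k e rs) H ->
  rows_finite (fps2_mul H (fps2_of_poly (polyx ((1 - 'X^(e * k`!)) ^+ k)))).
Proof.
move=> rs0 [N NE]; apply: (rows_finite_div rs0) => c.
have [A NA] := rows_finite_poly N c.
by exists A => a /NA <-; rewrite -fps2_mulA; apply: NE.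
Qed.

(** The difference of 'X^(n+1) has degree n with leading coefficient M (n + 1),
    nonzero in characteristic 0, so leading terms can be removed one at a
    time. *)
Lemma antidifference (F : numFieldType) (M : nat) (p : {poly F}) :
  (0 < M)%N -> exists q : {poly F}, q \Po ('X + M%:R%:P) - q = p.
Proof.
move=> M0; have [n] := ubnP (size p); elim: n p => // n IH p; rewrite ltnS => sp.
case: n => [|n] in IH sp *.
  exists 0; move: sp; rewrite leqn0 size_poly_eq0 => /eqP ->.
  by rewrite comp_poly0 subr0.
pose b : F := p`_n / (M * n.+1)%:R.
pose q0 : {poly F} := b *: 'X^(n.+1).
have dE : q0 \Po ('X + M%:R%:P) - q0 =
    \sum_(i < n.+1) (b * M%:R ^+ (n.+1 - i) *+ 'C(n.+1, i)) *: 'X^i.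
  rewrite /q0 comp_polyZ comp_Xn_poly -scalerBr ['X + _]addrC exprDn big_ord_recr /=.
  rewrite subnn expr0 mul1r binn mulr1n addrK scaler_sumr.
  apply: eq_bigr => i _; rewrite -polyC_exp mul_polyC -[RHS]scalerMnl -scalerA -scalerMnr //.
have [q qE] : exists q, q \Po ('X + M%:R%:P) - q =
                       p - (q0 \Po ('X + M%:R%:P) - q0).
  apply: IH; rewrite ltnS; apply/leq_sizeP => i; rewrite leq_eqVlt.
  have coefd m : (\sum_(i < n.+1)
       (b * M%:R ^+ (n.+1 - i) *+ 'C(n.+1, i)) *: 'X^i)`_m =
      if (m < n.+1)%N then b * M%:R ^+ (n.+1 - m) *+ 'C(n.+1, m) else 0 :> F.
    rewrite -(coef_poly n.+1 (fun i => b * M%:R ^+ (n.+1 - i) *+ 'C(n.+1, i)) m).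
    by rewrite poly_def.
  case/predU1P=> [<-|ni]; rewrite coefB dE coefd.
    rewrite ltnSn subSnn expr1 binSn -mulr_natr -mulrA -natrM /b mulfVK ?subrr //.
    by rewrite pnatr_eq0; lia.
  by rewrite ltnNge ni /= subr0 nth_default // (leq_trans sp).
exists (q + q0); rewrite comp_polyD -[RHS](subrK (q0 \Po ('X + M%:R%:P) - q0)) -qE.
by ring.
Qed.

(** One polynomial per residue class modulo M; unlike periodic coefficients, this
    form can be summed by [antidifference] class by class. *)
Definition ev_piecewise_poly (F : numFieldType) (M : nat) (u : nat -> int) : Prop :=
  exists p : nat -> {poly F}, (forall n, p (n + M)%N = p n) /\
    exists n0, forall n, (n0 <= n)%N -> (u n)%:~R = (p n).[n%:R].

(** Subtracting an antidifference of the given polynomials from u leaves an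
    eventually M-periodic sequence, which goes into the constant terms. *)
Lemma ev_piecewise_poly_diff (F : numFieldType) (M : nat) (u : nat -> int) :
    (0 < M)%N ->
    ev_piecewise_poly F M (fun n => u (n + M)%N - u n) ->
  ev_piecewise_poly F M u.
Proof.
move=> M0 [p [pM [n0 pE]]].
have qP n : exists q : {poly F}, q \Po ('X + M%:R%:P) - q == p n.
  by have [q <-] := antidifference (p n) M0; exists q.
pose q n := xchoose (qP n).
have qM n : q (n + M)%N = q n by apply: eq_xchoose => r; rewrite pM.
pose w n : F := (u n)%:~R - (q n).[n%:R].
have wM n : (n0 <= n)%N -> w (n + M)%N = w n.
  move=> /pE; have /eqP <- := xchooseP (qP n); rewrite -/(q n) hornerD hornerN.
  rewrite horner_comp hornerD hornerX hornerC rmorphB /= /w qM natrD => E.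
  by rewrite -(subrK (u n)%:~R (u _)%:~R) E; ring.
(* The offset n0 * M keeps the residue class and lands in the range where w is
   periodic. *)
pose C n := w (n %% M + n0 * M)%N.
exists (fun n => q n + (C n)%:P); split=> [n|].
  by rewrite qM /C modnDr.
exists (n0 * M)%N => n ln; rewrite hornerD hornerC.
suff -> : C n = w n by rewrite /w addrC subrK.
have /subnK dE : (n0 <= n %/ M)%N by rewrite leq_divRL.
have nE : n = (n %% M + n0 * M + (n %/ M - n0) * M)%N.
  by rewrite -addnA -mulnDl [(n0 + _)%N]addnC dE addnC -divn_eq.
rewrite {2}nE /C; elim: (n %/ M - n0)%N => [|i IH]; first by rewrite addn0.
rewrite mulSnr addnA wM //; nia.
Qed.

Lemma ev_piecewise_poly_rec (F : numFieldType) (M j : nat) (H : fps2) (c : nat) :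
    (0 < M)%N ->
    (exists A, forall a, (A <= a)%N ->
       fps2_mul H (fps2_of_poly (polyx ((1 - 'X^M) ^+ j))) a c = 0) ->
  ev_piecewise_poly F M (fun a => H a c).
Proof.
move=> M0 [A HA].
pose K i a := fps2_mul H (fps2_of_poly (polyx ((1 - 'X^M) ^+ i))) a c.
suff : ev_piecewise_poly F M (K 0%N).
  move=> [p [pM [n0 pE]]]; exists p; split=> //; exists n0 => n /pE <-.
  by rewrite /K fps2_mul_polyx0.
have : ev_piecewise_poly F M (K j).
  exists (fun=> 0); split=> //; exists A => n /HA; rewrite -/(K j n) => ->.
  by rewrite horner0.
elim: j {HA} => // j IH [p [pM [n0 pE]]]; apply: IH.
apply: ev_piecewise_poly_diff => //.
exists (fun n => p n \Po ('X + M%:R%:P)); split=> [n|]; first by rewrite pM.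
exists n0 => n ln; rewrite horner_comp hornerD hornerX hornerC -natrD -(pM n).
rewrite -pE; last by lia.
by rewrite /K fps2_mul_polyxS leq_addl addnK.
Qed.

Lemma ev_piecewise_poly_quasi (R : realType) (M : nat) (u : nat -> int) :
    (0 < M)%N -> ev_piecewise_poly (R[i] : numFieldType) M u ->
  eventually_quasipolynomial R u.
Proof.
move=> M0 [p [pM [n0 pE]]].
pose d := (\max_(i < M) size (p i))%N.
have pmod n : p n = p (n %% M)%N.
  rewrite {1}(divn_eq n M) addnC; elim: (n %/ M)%N => [|i IH].
    by rewrite mul0n addn0.
  by rewrite mulSnr addnA pM.
have sp n : (size (p n) <= d.+1)%N.
  rewrite pmod leqW //.
  exact: (@leq_bigmax _ (fun i : 'I_M => size (p i)) (Ordinal (ltn_pmod n M0))).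
exists (fun n => (p n).[n%:R]); split; last by exists n0.
exists d, (fun i n => (p n)`_i); split=> [i _|n].
  by exists M; split=> // n; rewrite pM.
by rewrite (horner_coef_wide _ (sp n)).
Qed.

(** * Denominators and conclusion *)

Lemma cyclotomic_productM (D1 D2 : {poly int}) :
  cyclotomic_product D1 -> cyclotomic_product D2 -> cyclotomic_product (D1 * D2).
Proof.
move=> [s1 [s1P ->]] [s2 [s2P ->]]; exists (s1 ++ s2).
by rewrite all_cat s1P s2P big_cat.
Qed.

Lemma cyclotomic_product_1subXn (n : nat) :
  (0 < n)%N -> cyclotomic_product (1 - 'X^n).
Proof.
move=> n0; exists (divisors n); split.
  by apply/allP => d; rewrite -dvdn_divisors //; apply: dvdn_gt0.
have Phi1 : 'Phi_1 = 'X - 1 :> {poly int}.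
  by have := prod_Cyclotomic (ltn0Sn 0); rewrite /= big_seq1 expr1.
have d1 : 1%N \in divisors n by rewrite -dvdn_divisors // dvd1n.
rewrite -opprB -(prod_Cyclotomic n0) !(big_rem _ d1) /=.
rewrite {1}/cyclotomic1 eqxx Phi1 -mulNr opprB; congr (_ * _).
apply: eq_big_seq => d; rewrite mem_rem_uniq ?divisors_uniq // inE.
by case/andP=> /negPf dn1 _; rewrite /cyclotomic1 dn1.
Qed.

Lemma cyclotomic_product_1subXnX (n j : nat) :
  (0 < n)%N -> cyclotomic_product ((1 - 'X^n) ^+ j).
Proof.
move=> n0; elim: j => [|j IH]; first by exists [::]; rewrite big_nil.
by rewrite exprS; apply: cyclotomic_productM => //; apply: cyclotomic_product_1subXn.
Qed.

Lemma common_den_coef00 (k e : nat) (rs : seq nat) :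
  (0 < e)%N -> (common_den k e rs)`_0`_0 = 1.
Proof.
move=> e0; have eM : (0 < e * k`!)%N by rewrite muln_gt0 e0 fact_gt0.
rewrite /common_den polyx_pow -!horner_coef0 !hornerM horner_exp horner_prod.
rewrite hornerD hornerN hornerM !horner_exp /varx hornerX hornerC.
rewrite [0 ^+ (e * _)]expr0n (gtn_eqF eM) mulr0 subr0 hornerC expr1n mul1r.
rewrite big1 ?hornerC // => i _.
by rewrite !hornerE expr0n (gtn_eqF e0) mulr0 subr0.
Qed.

(** The two parities differ only in the data (e, w, rs), with rs the list of
    exponents of t in the denominator. *)
Lemma rational_and_quasipolynomial (R : realType) (k e w : nat) (rs : seq nat) :
    (0 < k)%N -> (0 < e)%N -> (e * k = w.*2)%N -> all (leq 1) rs ->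
    (forall s, (s.*2 < k)%N -> (w - e * s)%N \in rs) ->
  (forall H, H = F_ k \/ H = G_ k ->
     exists N, fps2_is_frac H N (common_den k e rs)) /\
  (forall c, eventually_quasipolynomial R (g_ k c) /\
             eventually_quasipolynomial R (f_ k c)).
Proof.
move=> k0 e0 ek rs0 rsP; have frac := fps2_frac_FG k0 e0 ek rsP; split=> [H HE|c].
  by have [N NE] := frac H HE; exists N; split; first exact: common_den_coef00.
have M0 : (0 < e * k`!)%N by rewrite muln_gt0 e0 fact_gt0.
have quasi H : H = F_ k \/ H = G_ k ->
    eventually_quasipolynomial R (fun a => H a c).
  move=> HE; apply: (ev_piecewise_poly_quasi M0).
  by apply: (ev_piecewise_poly_rec _ M0 (fps2_frac_rows rs0 (frac H HE) c)).
by split; [apply: (quasi (G_ k)); right | apply: (quasi (F_ k)); left].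
Qed.

Theorem theorem2p2 (R : realType) (k : nat) (hk : (1 <= k)%N) :
  (forall H : fps2, H = F_ k \/ H = G_ k ->
     exists (N : {poly {poly int}}) (D : {poly int}),
       cyclotomic_product D /\
       (~~ odd k ->
          fps2_is_frac H N
            (polyx D * \prod_(1 <= i < (k./2).+1) (1 - vart ^+ i * varx))) /\
       (odd k ->
          fps2_is_frac H N
            (polyx D * \prod_(1 <= i < k.+1 | odd i)
                         (1 - vart ^+ i * varx ^+ 2)))) /\
  (forall c : nat,
     eventually_quasipolynomial R (g_ k c) /\
     eventually_quasipolynomial R (f_ k c)).
Proof.
have cyc e : (0 < e)%N -> cyclotomic_product ((1 - 'X^(e * k`!)) ^+ k).
  by move=> e0; apply: cyclotomic_product_1subXnX; rewrite muln_gt0 e0 fact_gt0.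
have kE := odd_double_half k; have [ok|ek] := boolP (odd k).
  have [||s sk|frac quasi] :=
    @rational_and_quasipolynomial R k 2 k [seq i <- index_iota 1 k.+1 | odd i] hk isT.
  - by rewrite mul2n.
  - by apply/allP => i; rewrite mem_filter mem_index_iota => /and3P[].
  - rewrite mem_filter mem_index_iota mul2n oddB ?odd_double ?ok //=; lia.
  split=> // H /frac[N NE]; exists N, ((1 - 'X^(2 * k`!)) ^+ k).
  by split; [exact: cyc | split=> // _; rewrite -[X in _ * X]big_filter].
have [||s sk|frac quasi] :=
  @rational_and_quasipolynomial R k 1 k./2 (index_iota 1 (k./2).+1) hk isT.
- by rewrite mul1n -[LHS]kE (negPf ek).
- by apply/allP => i; rewrite mem_index_iota => /andP[].
- by rewrite mem_index_iota; lia.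
split=> // H /frac[N NE]; exists N, ((1 - 'X^(1 * k`!)) ^+ k).
by split; [exact: cyc | split].
Qed.
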